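(* Let $R$ be a nonzero commutative ring with identity, let $G$ be a finite simple graph with vertex set $X=\{x_1,\dots,x_n\}$, and let $M(X;G)$ be the partially commutative metabelian Lie algebra over $R$ with set of generators $X$ and defining graph $G$. Let $x_i,x_j\in X$ be distinct. If $x_i$ and $x_j$ are not adjacent in $G$, then the annihilator $\{f\in R[X] : [x_i,x_j].f=0\}$ of $[x_i,x_j]$ in $R[X]$ is equal to the ideal $I^G_{i,j}$.
   Context: $M(X;G)$ is the quotient of the free metabelian Lie $R$-algebra on $X$ (metabelian: $[[a,b],[c,d]]=0$ identically) by the ideal generated by all $[x_k,x_l]$ with $\{x_k,x_l\}$ an edge of $G$. Its derived subalgebra $M'(X;G)$ is a module over the commutative polynomial ring $R[X]$, where $u.x=[u,x]$ for $u\in M'(X;G)$, $x\in X$, extended multiplicatively and linearly: $u.(fg)=(u.f).g$, $u.(f+g)=u.f+u.g$ (this is well defined because $M(X;G)$ is metabelian). The ideal $I^G_{i,j}$ of $R[X]$ is defined as follows. If $x_i$ and $x_j$ lie in different connected components of $G$, then $I^G_{i,j}=0$. If they lie in the same connected component, $I^G_{i,j}$ is the ideal generated by all monomials $y_1y_2\cdots y_s$ such that $(x_i,y_1,y_2,\dots,y_s,x_j)$ is a path in $G$ connecting $x_i$ and $x_j$. *)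

(* Defs.v *)
From HB Require Import structures.
From mathcomp Require Import all_boot all_order all_algebra.
From mathcomp Require Import boolp.
From mathcomp Require Import mpoly.

Set Implicit Arguments.
Unset Strict Implicit.
Unset Printing Implicit Defensive.

Import GRing.Theory.

Local Open Scope ring_scope.
Local Open Scope quotient_scope.

HB.mixin Record Lmodule_isLie (R : comNzRingType) L of GRing.Lmodule R L := {
  lie : L -> L -> L;
  lieDl : forall x y z, lie (x + y) z = lie x z + lie y z;
  lieDr : forall x y z, lie x (y + z) = lie x y + lie x z;
  lieZl : forall (a : R) x y, lie (a *: x) y = a *: lie x y;
  lieZr : forall (a : R) x y, lie x (a *: y) = a *: lie x y;
  liexx : forall x, lie x x = 0;
  lie_jacobi : forall x y z,
    lie (lie x y) z + lie (lie y z) x + lie (lie z x) y = 0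
}.

#[short(type="lieType")]
HB.structure Definition Lie (R : comNzRingType) :=
  {L of GRing.Lmodule R L & Lmodule_isLie R L}.

HB.mixin Record Lie_isMetabelian (R : comNzRingType) L of Lie R L := {
  lie_metabelian : forall a b c d : L, lie (lie a b) (lie c d) = 0
}.

#[short(type="metabLieType")]
HB.structure Definition MetabLie (R : comNzRingType) :=
  {L of Lie R L & Lie_isMetabelian R L}.

Section LieTheory.
Variables (R : comNzRingType) (L : lieType R).
Implicit Types x y z : L.

Lemma lie0l y : lie 0 y = 0.
Proof. by rewrite -[X in lie X _](scale0r 0) lieZl scale0r. Qed.

Lemma lie0r y : lie y 0 = 0.
Proof. by rewrite -[X in lie _ X](scale0r 0) lieZr scale0r. Qed.

Lemma lieNl x y : lie (- x) y = - lie x y.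
Proof. by rewrite -scaleN1r lieZl scaleN1r. Qed.

Lemma lieNr x y : lie x (- y) = - lie x y.
Proof. by rewrite -scaleN1r lieZr scaleN1r. Qed.

Lemma lie_anti x y : lie x y = - lie y x.
Proof.
apply/eqP; rewrite -addr_eq0; apply/eqP.
have := liexx (x + y).
by rewrite lieDl !lieDr !liexx add0r addr0.
Qed.

Lemma lie_swap x y z : lie (lie x y) z = lie (lie x z) y + lie x (lie y z).
Proof.
have /eqP := lie_jacobi x y z.
rewrite -addrA addr_eq0 opprD => /eqP ->.
by rewrite addrC -lieNl -lie_anti -lie_anti.
Qed.

End LieTheory.

(* Two-sided ideal of L generated by S; one-sided absorption suffices because
   the bracket is antisymmetric. *)
Inductive lie_ideal (R : comNzRingType) (L : lieType R) (S : L -> Prop) :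
    L -> Prop :=
  | LieIdeal_gen x of S x : lie_ideal S x
  | LieIdeal_0 : lie_ideal S 0
  | LieIdeal_add x y of lie_ideal S x & lie_ideal S y : lie_ideal S (x + y)
  | LieIdeal_scale a x of lie_ideal S x : lie_ideal S (a *: x)
  | LieIdeal_lie x y of lie_ideal S x : lie_ideal S (lie x y).

Section LieQuotient.
Variables (R : comNzRingType) (L : lieType R) (S : L -> Prop).
Local Notation I := (lie_ideal S).

Lemma lie_idealN x : I x -> I (- x).
Proof. by rewrite -scaleN1r; apply: LieIdeal_scale. Qed.

Lemma lie_ideal_lier x y : I x -> I (lie y x).
Proof.
by move=> Ix; rewrite lie_anti; apply: lie_idealN; apply: LieIdeal_lie.
Qed.

Definition lie_congr (x y : L) : bool := `[< I (x - y) >].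

Lemma lie_congr_refl : reflexive lie_congr.
Proof. by move=> x; apply/asboolP; rewrite subrr; apply: LieIdeal_0. Qed.

Lemma lie_congr_sym : ssrbool.symmetric lie_congr.
Proof.
suff imp x y : lie_congr x y -> lie_congr y x.
  by move=> x y; apply/idP/idP; apply: imp.
by move=> /asboolP/lie_idealN; rewrite opprB => Ixy; apply/asboolP.
Qed.

Lemma lie_congr_trans : transitive lie_congr.
Proof.
move=> y x z /asboolP Ixy /asboolP Iyz; apply/asboolP.
by rewrite -(subrK y x) -addrA; apply: LieIdeal_add.
Qed.

Canonical lie_congr_equiv :=
  EquivRel lie_congr lie_congr_refl lie_congr_sym lie_congr_trans.

Definition lie_quot := {eq_quot lie_congr}.
HB.instance Definition _ := Choice.on lie_quot.
HB.instance Definition _ := EqQuotient.on lie_quot.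

Definition lie_proj (x : L) : lie_quot := \pi_lie_quot x.

Lemma lie_projP x y : lie_proj x = lie_proj y <-> I (x - y).
Proof. by split=> [/eqmodP/asboolP | Ixy] //; apply/eqmodP/asboolP. Qed.

Lemma lie_projK (x : lie_quot) : lie_proj (repr x) = x.
Proof. exact: reprK. Qed.

Lemma lie_repr x : I (repr (lie_proj x) - x).
Proof. by apply/lie_projP; rewrite lie_projK. Qed.

Definition lq_opp (x : lie_quot) := lie_proj (- repr x).
Definition lq_add (x y : lie_quot) := lie_proj (repr x + repr y).
Definition lq_scale (a : R) (x : lie_quot) := lie_proj (a *: repr x).
Definition lq_lie (x y : lie_quot) := lie_proj (lie (repr x) (repr y)).

Lemma lq_oppE x : lq_opp (lie_proj x) = lie_proj (- x).
Proof.
by apply/lie_projP; rewrite -opprD; apply/lie_idealN/lie_repr.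
Qed.

Lemma lq_addE x y : lq_add (lie_proj x) (lie_proj y) = lie_proj (x + y).
Proof.
apply/lie_projP; rewrite opprD addrACA.
by apply: LieIdeal_add; apply: lie_repr.
Qed.

Lemma lq_scaleE a x : lq_scale a (lie_proj x) = lie_proj (a *: x).
Proof.
by apply/lie_projP; rewrite -scalerBr; apply/LieIdeal_scale/lie_repr.
Qed.

Lemma lq_lieE x y : lq_lie (lie_proj x) (lie_proj y) = lie_proj (lie x y).
Proof.
apply/lie_projP; set x' := repr _; set y' := repr _.
have -> : lie x' y' - lie x y = lie (x' - x) y' + lie x (y' - y).
  by rewrite lieDl lieDr lieNl lieNr addrA subrK.
apply: LieIdeal_add; first exact/LieIdeal_lie/lie_repr.
exact/lie_ideal_lier/lie_repr.
Qed.

Lemma lie_quot_ind (P : lie_quot -> Prop) :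
  (forall x, P (lie_proj x)) -> forall x, P x.
Proof. by move=> Pp x; rewrite -(lie_projK x). Qed.

Fact lq_addA : associative lq_add.
Proof.
elim/lie_quot_ind=> x; elim/lie_quot_ind=> y; elim/lie_quot_ind=> z.
by rewrite !lq_addE addrA.
Qed.

Fact lq_addC : commutative lq_add.
Proof.
by elim/lie_quot_ind=> x; elim/lie_quot_ind=> y; rewrite !lq_addE addrC.
Qed.

Fact lq_add0 : left_id (lie_proj 0) lq_add.
Proof. by elim/lie_quot_ind=> x; rewrite lq_addE add0r. Qed.

Fact lq_addN : left_inverse (lie_proj 0) lq_opp lq_add.
Proof. by elim/lie_quot_ind=> x; rewrite lq_oppE lq_addE addNr. Qed.

HB.instance Definition _ :=
  GRing.isZmodule.Build lie_quot lq_addA lq_addC lq_add0 lq_addN.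

Lemma lie_projD x y : lie_proj (x + y) = lie_proj x + lie_proj y.
Proof. by rewrite -lq_addE. Qed.

Lemma lie_proj0 : lie_proj 0 = 0.
Proof. by []. Qed.

Fact lq_scaleA a b x : lq_scale a (lq_scale b x) = lq_scale (a * b) x.
Proof. by elim/lie_quot_ind: x => x; rewrite !lq_scaleE scalerA. Qed.

Fact lq_scale1 : left_id 1 lq_scale.
Proof. by elim/lie_quot_ind=> x; rewrite lq_scaleE scale1r. Qed.

Fact lq_scaleDr : right_distributive lq_scale +%R.
Proof.
move=> a; elim/lie_quot_ind=> x; elim/lie_quot_ind=> y.
by rewrite -lie_projD !lq_scaleE scalerDr lie_projD.
Qed.

Fact lq_scaleDl x : {morph lq_scale^~ x : a b / a + b}.
Proof.
elim/lie_quot_ind: x => x a b.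
by rewrite /= !lq_scaleE scalerDl lie_projD.
Qed.

HB.instance Definition _ := GRing.Zmodule_isLmodule.Build R lie_quot
  lq_scaleA lq_scale1 lq_scaleDr lq_scaleDl.

Lemma lie_projZ a x : lie_proj (a *: x) = a *: lie_proj x.
Proof. by rewrite -lq_scaleE. Qed.

Fact lq_lieDl x y z : lq_lie (x + y) z = lq_lie x z + lq_lie y z.
Proof.
elim/lie_quot_ind: x => x; elim/lie_quot_ind: y => y.
elim/lie_quot_ind: z => z.
by rewrite -lie_projD !lq_lieE lieDl lie_projD.
Qed.

Fact lq_lieDr x y z : lq_lie x (y + z) = lq_lie x y + lq_lie x z.
Proof.
elim/lie_quot_ind: x => x; elim/lie_quot_ind: y => y.
elim/lie_quot_ind: z => z.
by rewrite -lie_projD !lq_lieE lieDr lie_projD.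
Qed.

Fact lq_lieZl a x y : lq_lie (a *: x) y = a *: lq_lie x y.
Proof.
elim/lie_quot_ind: x => x; elim/lie_quot_ind: y => y.
by rewrite -lie_projZ !lq_lieE lieZl lie_projZ.
Qed.

Fact lq_lieZr a x y : lq_lie x (a *: y) = a *: lq_lie x y.
Proof.
elim/lie_quot_ind: x => x; elim/lie_quot_ind: y => y.
by rewrite -lie_projZ !lq_lieE lieZr lie_projZ.
Qed.

Fact lq_liexx x : lq_lie x x = 0.
Proof. by elim/lie_quot_ind: x => x; rewrite lq_lieE liexx lie_proj0. Qed.

Fact lq_jacobi x y z :
  lq_lie (lq_lie x y) z + lq_lie (lq_lie y z) x + lq_lie (lq_lie z x) y = 0.
Proof.
elim/lie_quot_ind: x => x; elim/lie_quot_ind: y => y.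
elim/lie_quot_ind: z => z.
by rewrite !lq_lieE -!lie_projD lie_jacobi lie_proj0.
Qed.

HB.instance Definition _ := Lmodule_isLie.Build R lie_quot
  lq_lieDl lq_lieDr lq_lieZl lq_lieZr lq_liexx lq_jacobi.

Lemma lie_proj_lie x y : lie_proj (lie x y) = lie (lie_proj x) (lie_proj y).
Proof. by rewrite -lq_lieE. Qed.

End LieQuotient.

Section MetabLieQuotient.
Variables (R : comNzRingType) (L : metabLieType R) (S : L -> Prop).

Fact lq_metabelian (a b c d : lie_quot S) : lie (lie a b) (lie c d) = 0.
Proof.
elim/lie_quot_ind: a => a; elim/lie_quot_ind: b => b.
elim/lie_quot_ind: c => c; elim/lie_quot_ind: d => d.
by rewrite -!lie_proj_lie lie_metabelian lie_proj0.
Qed.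

HB.instance Definition _ :=
  Lie_isMetabelian.Build R (lie_quot S) lq_metabelian.

End MetabLieQuotient.

(* The free metabelian Lie R-algebra on n generators, as the algebra of formal
   Lie expressions modulo the least congruence imposing the axioms of a
   metabelian Lie R-algebra. *)
Inductive lterm (R : Type) (n : nat) : Type :=
  | TGen of 'I_n
  | TZero
  | TOpp of lterm R n
  | TAdd of lterm R n & lterm R n
  | TScale of R & lterm R n
  | TLie of lterm R n & lterm R n.

Arguments TGen {R n}.
Arguments TZero {R n}.

HB.instance Definition _ (R : Type) (n : nat) := gen_eqMixin (lterm R n).
HB.instance Definition _ (R : Type) (n : nat) := gen_choiceMixin (lterm R n).

Inductive lterm_eq (R : comNzRingType) (n : nat) :
    lterm R n -> lterm R n -> Prop :=
  | TE_refl t : lterm_eq t t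
  | TE_sym s t of lterm_eq s t : lterm_eq t s
  | TE_trans s t u of lterm_eq s t & lterm_eq t u : lterm_eq s u
  | TE_opp s t of lterm_eq s t : lterm_eq (TOpp s) (TOpp t)
  | TE_add s s' t t' of lterm_eq s s' & lterm_eq t t' :
      lterm_eq (TAdd s t) (TAdd s' t')
  | TE_scale a s t of lterm_eq s t : lterm_eq (TScale a s) (TScale a t)
  | TE_lie s s' t t' of lterm_eq s s' & lterm_eq t t' :
      lterm_eq (TLie s t) (TLie s' t')
  | TE_addA s t u : lterm_eq (TAdd s (TAdd t u)) (TAdd (TAdd s t) u)
  | TE_addC s t : lterm_eq (TAdd s t) (TAdd t s)
  | TE_add0 t : lterm_eq (TAdd TZero t) t
  | TE_addN t : lterm_eq (TAdd (TOpp t) t) TZero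
  | TE_scaleA a b t : lterm_eq (TScale a (TScale b t)) (TScale (a * b) t)
  | TE_scale1 t : lterm_eq (TScale 1 t) t
  | TE_scaleDr a s t :
      lterm_eq (TScale a (TAdd s t)) (TAdd (TScale a s) (TScale a t))
  | TE_scaleDl a b t :
      lterm_eq (TScale (a + b) t) (TAdd (TScale a t) (TScale b t))
  | TE_lieDl s t u : lterm_eq (TLie (TAdd s t) u) (TAdd (TLie s u) (TLie t u))
  | TE_lieDr s t u : lterm_eq (TLie s (TAdd t u)) (TAdd (TLie s t) (TLie s u))
  | TE_lieZl a s t : lterm_eq (TLie (TScale a s) t) (TScale a (TLie s t))
  | TE_lieZr a s t : lterm_eq (TLie s (TScale a t)) (TScale a (TLie s t))
  | TE_liexx t : lterm_eq (TLie t t) TZero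
  | TE_jacobi s t u :
      lterm_eq (TAdd (TAdd (TLie (TLie s t) u) (TLie (TLie t u) s))
                     (TLie (TLie u s) t)) TZero
  | TE_metab s t u v : lterm_eq (TLie (TLie s t) (TLie u v)) TZero.

Section FreeMetabelian.
Variables (R : comNzRingType) (n : nat).
Local Notation T := (lterm R n).

Definition lterm_eqb (s t : T) : bool := `[< lterm_eq s t >].

Lemma lterm_eqb_refl : reflexive lterm_eqb.
Proof. by move=> t; apply/asboolP/TE_refl. Qed.

Lemma lterm_eqb_sym : ssrbool.symmetric lterm_eqb.
Proof.
by move=> s t; apply/idP/idP => /asboolP E; apply/asboolP/TE_sym.
Qed.

Lemma lterm_eqb_trans : transitive lterm_eqb.
Proof.
by move=> t s u /asboolP E /asboolP F; apply/asboolP/(TE_trans E F).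
Qed.

Canonical lterm_equiv :=
  EquivRel lterm_eqb lterm_eqb_refl lterm_eqb_sym lterm_eqb_trans.

Definition free_metab := {eq_quot lterm_eqb}.
HB.instance Definition _ := Choice.on free_metab.
HB.instance Definition _ := EqQuotient.on free_metab.

Definition fm_cls (t : T) : free_metab := \pi_free_metab t.

Lemma fm_clsP s t : fm_cls s = fm_cls t <-> lterm_eq s t.
Proof. by split=> [/eqmodP/asboolP | E] //; apply/eqmodP/asboolP. Qed.

Lemma fm_clsK (x : free_metab) : fm_cls (repr x) = x.
Proof. exact: reprK. Qed.

Lemma fm_repr t : lterm_eq (repr (fm_cls t)) t.
Proof. by apply/fm_clsP; rewrite fm_clsK. Qed.

Definition fm_opp (x : free_metab) := fm_cls (TOpp (repr x)).
Definition fm_add (x y : free_metab) := fm_cls (TAdd (repr x) (repr y)).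
Definition fm_scale (a : R) (x : free_metab) := fm_cls (TScale a (repr x)).
Definition fm_lie (x y : free_metab) := fm_cls (TLie (repr x) (repr y)).

Lemma fm_oppE s : fm_opp (fm_cls s) = fm_cls (TOpp s).
Proof. by apply/fm_clsP/TE_opp/fm_repr. Qed.

Lemma fm_addE s t : fm_add (fm_cls s) (fm_cls t) = fm_cls (TAdd s t).
Proof. by apply/fm_clsP/TE_add; apply: fm_repr. Qed.

Lemma fm_scaleE a s : fm_scale a (fm_cls s) = fm_cls (TScale a s).
Proof. by apply/fm_clsP/TE_scale/fm_repr. Qed.

Lemma fm_lieE s t : fm_lie (fm_cls s) (fm_cls t) = fm_cls (TLie s t).
Proof. by apply/fm_clsP/TE_lie; apply: fm_repr. Qed.

Let fmE := (fm_oppE, fm_addE, fm_scaleE, fm_lieE).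

Lemma free_metab_ind (P : free_metab -> Prop) :
  (forall t, P (fm_cls t)) -> forall x, P x.
Proof. by move=> Pc x; rewrite -(fm_clsK x). Qed.

Fact fm_addA : associative fm_add.
Proof.
elim/free_metab_ind=> x; elim/free_metab_ind=> y; elim/free_metab_ind=> z.
by rewrite !fmE; apply/fm_clsP/TE_addA.
Qed.

Fact fm_addC : commutative fm_add.
Proof.
elim/free_metab_ind=> x; elim/free_metab_ind=> y.
by rewrite !fmE; apply/fm_clsP/TE_addC.
Qed.

Fact fm_add0 : left_id (fm_cls TZero) fm_add.
Proof. by elim/free_metab_ind=> x; rewrite fmE; apply/fm_clsP/TE_add0. Qed.

Fact fm_addN : left_inverse (fm_cls TZero) fm_opp fm_add.
Proof. by elim/free_metab_ind=> x; rewrite !fmE; apply/fm_clsP/TE_addN. Qed.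

HB.instance Definition _ :=
  GRing.isZmodule.Build free_metab fm_addA fm_addC fm_add0 fm_addN.

Lemma fm_cls_add s t : fm_cls (TAdd s t) = fm_cls s + fm_cls t.
Proof. by rewrite -fm_addE. Qed.

Lemma fm_cls_opp s : fm_cls (TOpp s) = - fm_cls s.
Proof. by rewrite -fm_oppE. Qed.

Lemma fm_cls_zero : fm_cls TZero = 0.
Proof. by []. Qed.

Fact fm_scaleA a b x : fm_scale a (fm_scale b x) = fm_scale (a * b) x.
Proof.
by elim/free_metab_ind: x => x; rewrite !fmE; apply/fm_clsP/TE_scaleA.
Qed.

Fact fm_scale1 : left_id 1 fm_scale.
Proof. by elim/free_metab_ind=> x; rewrite fmE; apply/fm_clsP/TE_scale1. Qed.

Fact fm_scaleDr : right_distributive fm_scale +%R.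
Proof.
move=> a; elim/free_metab_ind=> x; elim/free_metab_ind=> y.
by rewrite -fm_cls_add !fmE -fm_cls_add; apply/fm_clsP/TE_scaleDr.
Qed.

Fact fm_scaleDl x : {morph fm_scale^~ x : a b / a + b}.
Proof.
elim/free_metab_ind: x => x a b.
by rewrite /= !fmE -fm_cls_add; apply/fm_clsP/TE_scaleDl.
Qed.

HB.instance Definition _ := GRing.Zmodule_isLmodule.Build R free_metab
  fm_scaleA fm_scale1 fm_scaleDr fm_scaleDl.

Lemma fm_cls_scale a s : fm_cls (TScale a s) = a *: fm_cls s.
Proof. by rewrite -fm_scaleE. Qed.

Fact fm_lieDl x y z : fm_lie (x + y) z = fm_lie x z + fm_lie y z.
Proof.
elim/free_metab_ind: x => x; elim/free_metab_ind: y => y.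
elim/free_metab_ind: z => z.
by rewrite -fm_cls_add !fmE -fm_cls_add; apply/fm_clsP/TE_lieDl.
Qed.

Fact fm_lieDr x y z : fm_lie x (y + z) = fm_lie x y + fm_lie x z.
Proof.
elim/free_metab_ind: x => x; elim/free_metab_ind: y => y.
elim/free_metab_ind: z => z.
by rewrite -fm_cls_add !fmE -fm_cls_add; apply/fm_clsP/TE_lieDr.
Qed.

Fact fm_lieZl a x y : fm_lie (a *: x) y = a *: fm_lie x y.
Proof.
elim/free_metab_ind: x => x; elim/free_metab_ind: y => y.
by rewrite -fm_cls_scale !fmE -fm_cls_scale; apply/fm_clsP/TE_lieZl.
Qed.

Fact fm_lieZr a x y : fm_lie x (a *: y) = a *: fm_lie x y.
Proof.
elim/free_metab_ind: x => x; elim/free_metab_ind: y => y.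
by rewrite -fm_cls_scale !fmE -fm_cls_scale; apply/fm_clsP/TE_lieZr.
Qed.

Fact fm_liexx x : fm_lie x x = 0.
Proof.
by elim/free_metab_ind: x => x; rewrite fmE; apply/fm_clsP/TE_liexx.
Qed.

Fact fm_jacobi x y z :
  fm_lie (fm_lie x y) z + fm_lie (fm_lie y z) x + fm_lie (fm_lie z x) y = 0.
Proof.
elim/free_metab_ind: x => x; elim/free_metab_ind: y => y.
elim/free_metab_ind: z => z.
by rewrite !fmE -!fm_cls_add; apply/fm_clsP/TE_jacobi.
Qed.

HB.instance Definition _ := Lmodule_isLie.Build R free_metab
  fm_lieDl fm_lieDr fm_lieZl fm_lieZr fm_liexx fm_jacobi.

Lemma fm_cls_lie s t : fm_cls (TLie s t) = lie (fm_cls s) (fm_cls t).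
Proof. by rewrite -fm_lieE. Qed.

Fact fm_metabelian (a b c d : free_metab) : lie (lie a b) (lie c d) = 0.
Proof.
elim/free_metab_ind: a => a; elim/free_metab_ind: b => b.
elim/free_metab_ind: c => c; elim/free_metab_ind: d => d.
by rewrite -!fm_cls_lie; apply/fm_clsP/TE_metab.
Qed.

HB.instance Definition _ :=
  Lie_isMetabelian.Build R free_metab fm_metabelian.

Definition fm_gen (i : 'I_n) : free_metab := fm_cls (TGen i).

End FreeMetabelian.

Section PartiallyCommutative.
Variables (R : comNzRingType) (n : nat) (G : rel 'I_n).

Definition edge_relator (u : free_metab R n) : Prop :=
  exists k l : 'I_n, G k l /\ u = lie (fm_gen R k) (fm_gen R l).

Definition pc_metab := lie_quot edge_relator.
HB.instance Definition _ := MetabLie.on pc_metab.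

Definition pc_gen (i : 'I_n) : pc_metab := lie_proj edge_relator (fm_gen R i).

End PartiallyCommutative.

Section PolynomialAction.
Variables (R : comNzRingType) (n : nat) (L : lieType R) (x : 'I_n -> L).

Definition monom_act (u : L) (m : 'X_{1..n}) : L :=
  foldl (fun v i => iter (m i) (fun w => lie w (x i)) v) u (enum 'I_n).

(* u.f, determined by u.x_i = [u, x_i]; the formula makes sense for every u,
   but it is an R[X]-module action only on the derived subalgebra of a
   metabelian algebra: see poly_actX, poly_actD, poly_actDl, poly_actM below. *)
Definition poly_act (u : L) (f : {mpoly R[n]}) : L :=
  \sum_(m <- msupp f) f@_m *: monom_act u m.

End PolynomialAction.

(* The derived subalgebra [L, L]: scalars are absorbed into the brackets. *)
Definition derived (R : comNzRingType) (L : lieType R) (u : L) : Prop :=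
  exists s : seq (L * L), u = \sum_(p <- s) lie p.1 p.2.

Section PolynomialActionTheory.
Variables (R : comNzRingType) (n : nat) (L : metabLieType R) (x : 'I_n -> L).
Implicit Types (u v : L) (f g : {mpoly R[n]}).

Lemma derived_lie (u v : L) : derived (lie u v).
Proof. by exists [:: (u, v)]; rewrite big_seq1. Qed.

Lemma derived_monom_act u m : derived u -> derived (monom_act x u m).
Proof.
rewrite /monom_act; elim: (enum 'I_n) u => //= i s IH u du; apply: IH.
by elim: (m i) => //= k _; apply: derived_lie.
Qed.

Lemma lie_derived u v a : derived u -> lie u (lie v a) = 0.
Proof.
case=> s ->; elim/big_ind: _ => [|y z|p _].
- by rewrite lie0l.
- by rewrite lieDl => -> ->; rewrite addr0.
- by rewrite lie_metabelian.
Qed.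

Lemma lie_derivedC u a b : derived u -> lie (lie u a) b = lie (lie u b) a.
Proof. by move=> du; rewrite lie_swap lie_derived // addr0. Qed.

Local Notation ad i := (fun w => lie w (x i)).

Let derived_iter u i k : derived u -> derived (iter k (ad i) u).
Proof. by elim: k => //= k IH du; apply: derived_lie. Qed.

Let iter_adC u i j k l : derived u ->
  iter k (ad i) (iter l (ad j) u) = iter l (ad j) (iter k (ad i) u).
Proof.
move=> du; elim: k => //= k ->.
elim: l => //= l <-; apply: lie_derivedC.
by do 2!apply: derived_iter.
Qed.

Let foldl_iterC u (m : 'X_{1..n}) s i k : derived u ->
  iter k (ad i) (foldl (fun v j => iter (m j) (ad j) v) u s)
  = foldl (fun v j => iter (m j) (ad j) v) (iter k (ad i) u) s.
Proof.
elim: s u => //= j s IH u du.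
rewrite (IH _ (derived_iter j (m j) du)); congr foldl.
exact: iter_adC.
Qed.

Lemma monom_actD u m m' : derived u ->
  monom_act x u (m + m')%MM = monom_act x (monom_act x u m) m'.
Proof.
rewrite /monom_act; elim: (enum 'I_n) u => //= i s IH u du.
have di := derived_iter i (m i) du.
rewrite mnmDE addnC iterD (IH _ (derived_iter i (m' i) di)); congr foldl.
by rewrite -(foldl_iterC m s i (m' i) di).
Qed.

Lemma monom_act0 u : monom_act x u 0%MM = u.
Proof.
by rewrite /monom_act; elim: (enum 'I_n) => //= i s; rewrite mnm0E.
Qed.

Lemma monom_act1 u i : monom_act x u U_(i)%MM = lie u (x i).
Proof.
rewrite /monom_act.
suff E s v : uniq s ->
    foldl (fun w j => iter (U_(i)%MM j) (ad j) w) v s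
    = if i \in s then lie v (x i) else v.
  by rewrite E ?enum_uniq // mem_enum.
elim: s v => //= j s IH v /andP[js us]; rewrite IH // in_cons mnm1E.
by case: eqP => //= ->; rewrite (negbTE js).
Qed.

Lemma monom_act_linear a u v m :
  monom_act x (a *: u + v) m = a *: monom_act x u m + monom_act x v m.
Proof.
rewrite /monom_act; elim: (enum 'I_n) u v => //= i s IH u v.
rewrite -IH; congr foldl.
by elim: (m i) => //= k ->; rewrite lieDl lieZl.
Qed.

Lemma monom_act_0l m : monom_act x 0 m = 0.
Proof.
have := monom_act_linear (-1) 0 0 m.
by rewrite scaler0 addr0 scaleN1r addNr.
Qed.

Lemma poly_act_supp u f (s : seq 'X_{1..n}) : uniq s -> {subset msupp f <= s} ->
  poly_act x u f = \sum_(m <- s) f@_m *: monom_act x u m.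
Proof.
move=> us sub; rewrite [RHS](bigID (fun m => m \in msupp f)) /=.
rewrite [X in _ + X]big1 ?addr0; last first.
  by move=> m /memN_msupp_eq0 ->; rewrite scale0r.
rewrite -[RHS]big_filter; apply: perm_big; apply: uniq_perm.
- exact: msupp_uniq.
- exact: filter_uniq.
- move=> m; rewrite mem_filter; case: (boolP (m \in msupp f)) => //= mf.
  by rewrite sub.
Qed.

Lemma poly_act_linear u a f g :
  poly_act x u (a *: f + g) = a *: poly_act x u f + poly_act x u g.
Proof.
pose s := undup (msupp f ++ msupp g ++ msupp (a *: f + g)).
have us : uniq s by apply: undup_uniq.
rewrite !(@poly_act_supp _ _ s) //; first last.
- by move=> m; rewrite mem_undup !mem_cat => ->; rewrite ?orbT.
- by move=> m; rewrite mem_undup !mem_cat => ->; rewrite ?orbT.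
- by move=> m; rewrite mem_undup !mem_cat => ->; rewrite ?orbT.
rewrite scaler_sumr -big_split /=; apply: eq_bigr => m _.
by rewrite mcoeffD mcoeffZ scalerDl scalerA.
Qed.

Lemma poly_actD u f g :
  poly_act x u (f + g) = poly_act x u f + poly_act x u g.
Proof. by rewrite -[f in LHS]scale1r poly_act_linear scale1r. Qed.

Lemma poly_act0 u : poly_act x u 0 = 0.
Proof. by rewrite /poly_act msupp0 big_nil. Qed.

Lemma poly_actZ u a f : poly_act x u (a *: f) = a *: poly_act x u f.
Proof. by rewrite -[a *: f]addr0 poly_act_linear poly_act0 addr0. Qed.

Lemma poly_act_sum u (I : Type) (s : seq I) (F : I -> {mpoly R[n]}) :
  poly_act x u (\sum_(i <- s) F i) = \sum_(i <- s) poly_act x u (F i).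
Proof.
by elim: s => [|i s IH]; rewrite ?big_nil ?poly_act0 // !big_cons poly_actD IH.
Qed.

Lemma poly_actDl u v f :
  poly_act x (u + v) f = poly_act x u f + poly_act x v f.
Proof.
rewrite /poly_act -big_split /=; apply: eq_bigr => m _.
by rewrite -scalerDr -[u in u + v]scale1r monom_act_linear scale1r.
Qed.

Lemma poly_act_monom u m : poly_act x u 'X_[m] = monom_act x u m.
Proof. by rewrite /poly_act msuppX big_seq1 mcoeffX eqxx scale1r. Qed.

Lemma poly_act1 u : poly_act x u 1 = u.
Proof. by rewrite -mpolyX0 poly_act_monom monom_act0. Qed.

Lemma poly_actX u i : poly_act x u 'X_i = lie u (x i).
Proof. by rewrite poly_act_monom monom_act1. Qed.

Lemma derived_poly_act u f : derived u -> derived (poly_act x u f).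
Proof.
move=> du; rewrite /poly_act; elim/big_ind: _ => [|_ _ [s ->] [t ->]|m _].
- by exists [::]; rewrite big_nil.
- by exists (s ++ t); rewrite big_cat.
- case: (derived_monom_act m du) => s ->.
  exists [seq (f@_m *: p.1, p.2) | p <- s]; rewrite scaler_sumr big_map.
  by apply: eq_bigr => p _; rewrite lieZl.
Qed.

Lemma poly_actM u f g : derived u ->
  poly_act x u (f * g) = poly_act x (poly_act x u f) g.
Proof.
move=> du; rewrite [in LHS](mpolyE f) [in LHS](mpolyE g) mulr_suml poly_act_sum.
transitivity (\sum_(m <- msupp f) \sum_(m' <- msupp g)
    g@_m' *: (f@_m *: monom_act x u (m + m')%MM)).
  apply: eq_bigr => m _; rewrite mulr_sumr poly_act_sum; apply: eq_bigr => m' _.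
  rewrite -scalerAl -scalerAr -mpolyXD !poly_actZ poly_act_monom.
  by rewrite !scalerA mulrC.
rewrite exchange_big /=; apply: eq_bigr => m' _.
rewrite -scaler_sumr /poly_act; congr (_ *: _).
elim: (msupp f : seq _) => [|m s IH]; first by rewrite !big_nil monom_act_0l.
by rewrite !big_cons monom_act_linear -IH monom_actD.
Qed.

End PolynomialActionTheory.

Inductive ideal_gen (A : comNzRingType) (S : A -> Prop) : A -> Prop :=
  | IdealGen_gen f of S f : ideal_gen S f
  | IdealGen_0 : ideal_gen S 0
  | IdealGen_add f g of ideal_gen S f & ideal_gen S g : ideal_gen S (f + g)
  | IdealGen_mul f g of ideal_gen S f : ideal_gen S (g * f).

Section PathIdeal.
Variables (R : comNzRingType) (n : nat) (G : rel 'I_n).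

(* The vertices of a path are distinct. Allowing repetitions would not change
   the ideal below: the monomial of a walk is a multiple of that of a path. *)
Definition is_path (i : 'I_n) (ys : seq 'I_n) (j : 'I_n) : bool :=
  path G i (rcons ys j) && uniq (i :: rcons ys j).

Definition path_monomial (i j : 'I_n) (f : {mpoly R[n]}) : Prop :=
  exists2 ys : seq 'I_n, is_path i ys j & f = \prod_(y <- ys) 'X_y.

Definition path_ideal (i j : 'I_n) (f : {mpoly R[n]}) : Prop :=
  if connect G i j then ideal_gen (path_monomial i j) f else f = 0.

End PathIdeal.

Definition annihilator (R : comNzRingType) (n : nat) (L : lieType R)
    (x : 'I_n -> L) (u : L) (f : {mpoly R[n]}) : Prop :=
  poly_act x u f = 0.

(* Main.v *)
Require Import Defs.
From HB Require Import structures.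
From mathcomp Require Import all_boot all_order all_algebra.
From mathcomp Require Import boolp.
From mathcomp Require Import mpoly.
From mathcomp Require Import ring.

(** The annihilator contains the path ideal because, when [x_k] and [x_l]
are adjacent, the Jacobi identity reads
[[x_k, x_j].x_l = [x_l, x_j].x_k]. Consuming a
path from [x_i] to [x_j] one vertex at a time moves the left entry of the
bracket along the path until it is adjacent to [x_j], where the bracket
vanishes (path_annihilates).

For the converse, the path ideal is a monomial ideal, so it is enough to show
that every monomial [m] occurring in an annihilating polynomial [f] is
divisible by a path monomial, i.e. that some path from [x_i] to [x_j] has all
its interior vertices in the support of [m] (annihilator_support_path). Suppose
there is none, and let [C] be the set of vertices reachable from [x_i] through
the support of [m] while avoiding [x_j]; no vertex of [C] is adjacent to [x_j].
Let [A = R[X]] and put on [A * A] the metabelian bracket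
[[(v, w), (v', w')] = (0, w v' - w' v)]. Send [x_k] to [(y_k, a_k)], where
[y_k = x_k] if [k] is [i], [j] or in the support of [m], and [y_k = 0]
otherwise, while [a_k = x_k] if [k] is in [C], and [a_k = 0] otherwise.
An edge inside [C] gives [x_k x_l - x_l x_k = 0]; an edge leaving [C] ends at a
vertex with [y_l = 0], since that vertex would otherwise belong to [C]. Hence
this assignment extends to [M(X;G)] by the universal property (pc_metab_lift).
It sends [[x_i, x_j].f] to [(0, x_i x_j f(y))] (affine_poly_act), and
substituting [y] does not change the coefficient at [m] (mcoeff_partial_eval).
So [[x_i, x_j].f = 0] forces the coefficient of [f] at [m] to vanish. *)

Import GRing.Theory.

Local Open Scope ring_scope.

(** * Morphisms of Lie algebras and the polynomial action *)

Definition lie_morphism {R : comNzRingType} {L L' : lieType R}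
    (phi : L -> L') : Prop :=
  [/\ forall u v, phi (u + v) = phi u + phi v,
      forall a u, phi (a *: u) = a *: phi u
    & forall u v, phi (lie u v) = lie (phi u) (phi v)].

Section Morphisms.
Context {R : comNzRingType} {n : nat}.

Lemma lie_morphism0 (L L' : lieType R) (phi : L -> L') :
  lie_morphism phi -> phi 0 = 0.
Proof. by case=> _ phiZ _; rewrite -[0 in LHS](scale0r 0) phiZ scale0r. Qed.

Lemma lie_morphism_poly_act (L L' : lieType R) (phi : L -> L')
    (x : 'I_n -> L) u (f : {mpoly R[n]}) : lie_morphism phi ->
  phi (poly_act x u f) = poly_act (phi \o x) (phi u) f.
Proof.
move=> mphi; have [phiD phiZ phiL] := mphi.
have phi_act v m : phi (monom_act x v m) = monom_act (phi \o x) (phi v) m.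
  rewrite /monom_act; elim: (enum 'I_n) v => //= k s IH v; rewrite IH.
  by congr foldl; elim: (m k) => //= d <-; rewrite phiL.
rewrite /poly_act; elim: (msupp f : seq _) => [|m s IH].
  by rewrite !big_nil lie_morphism0.
by rewrite !big_cons phiD phiZ IH phi_act.
Qed.

End Morphisms.

(** * The universal property of M(X;G) *)

Section UniversalProperty.
Context {R : comNzRingType} {n : nat} {L : metabLieType R} (x : 'I_n -> L).

Fixpoint term_eval (t : lterm R n) : L :=
  match t with
  | TGen k => x k
  | TZero => 0
  | TOpp s => - term_eval s
  | TAdd s t => term_eval s + term_eval t
  | TScale a s => a *: term_eval s
  | TLie s t => lie (term_eval s) (term_eval t)
  end.

Lemma term_eval_eq s t : lterm_eq s t -> term_eval s = term_eval t.
Proof.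
elim=> //= {s t}.
- by move=> s t u _ -> _ ->.
- by move=> s t _ ->.
- by move=> s s' t t' _ -> _ ->.
- by move=> a s t _ ->.
- by move=> s s' t t' _ -> _ ->.
- by move=> s t u; rewrite addrA.
- by move=> s t; rewrite addrC.
- by move=> t; rewrite add0r.
- by move=> t; rewrite addNr.
- by move=> a b t; rewrite scalerA.
- by move=> t; rewrite scale1r.
- by move=> a s t; rewrite scalerDr.
- by move=> a b t; rewrite scalerDl.
- by move=> s t u; rewrite lieDl.
- by move=> s t u; rewrite lieDr.
- by move=> a s t; rewrite lieZl.
- by move=> a s t; rewrite lieZr.
- by move=> t; rewrite liexx.
- by move=> s t u; rewrite lie_jacobi.
- by move=> s t u v; rewrite lie_metabelian.
Qed.

Lemma free_metab_lift : exists2 phi : free_metab R n -> L,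
  lie_morphism phi & forall k, phi (fm_gen R k) = x k.
Proof.
pose phi (u : free_metab R n) := term_eval (repr u).
have phiE t : phi (fm_cls t) = term_eval t by apply/term_eval_eq/fm_repr.
exists phi => [|k]; last by rewrite phiE.
split=> [u v|a u|u v]; elim/free_metab_ind: u => s.
- by elim/free_metab_ind: v => t; rewrite -fm_cls_add !phiE.
- by rewrite -fm_cls_scale !phiE.
- by elim/free_metab_ind: v => t; rewrite -fm_cls_lie !phiE.
Qed.

(** The relators generate the ideal defining M(X;G), so a morphism from the free
metabelian algebra factors through M(X;G) as soon as it kills them. *)
Lemma pc_metab_lift (G : rel 'I_n) :
  (forall k l, G k l -> lie (x k) (x l) = 0) ->
  exists2 phi : pc_metab R G -> L,
    lie_morphism phi & forall k, phi (pc_gen R G k) = x k.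
Proof.
move=> Gx; have [psi mpsi psiE] := free_metab_lift.
have [psiD psiZ psiL] := mpsi.
have psi_ideal u : lie_ideal (@edge_relator R n G) u -> psi u = 0.
  elim=> {u} [_ [k [l [Gkl ->]]]||u v _ pu _ pv|a u _ pu|u v _ pu].
  - by rewrite psiL !psiE Gx.
  - exact: lie_morphism0.
  - by rewrite psiD pu pv addr0.
  - by rewrite psiZ pu scaler0.
  - by rewrite psiL pu lie0l.
pose phi (u : pc_metab R G) := psi (repr u).
have phiE u : phi (lie_proj (@edge_relator R n G) u) = psi u.
  have := psi_ideal _ (lie_repr (@edge_relator R n G) u).
  by rewrite -scaleN1r psiD psiZ scaleN1r => /eqP; rewrite subr_eq0 => /eqP.
exists phi => [|k]; last by rewrite phiE psiE.
split=> [u v|a u|u v]; elim/lie_quot_ind: u => s.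
- by elim/lie_quot_ind: v => t; rewrite -lie_projD !phiE.
- by rewrite -lie_projZ !phiE.
- by elim/lie_quot_ind: v => t; rewrite -lie_proj_lie !phiE.
Qed.

End UniversalProperty.

(** * Metabelian algebras from a commutative algebra *)

Section AffineLie.
Context {R : comNzRingType} {B : comAlgType R}.

(** The semidirect product of the abelian Lie algebra [B] (first component) by
[B] seen as a module over itself (second component). The derived subalgebra
lies in the second component, on which the first acts by multiplication; this
makes the polynomial action computable. *)
Definition affine_lie : Type := (B * B)%type.
HB.instance Definition _ := GRing.Lmodule.on affine_lie.

Definition affine_bracket (p q : affine_lie) : affine_lie :=
  (0, p.2 * q.1 - q.2 * p.1).

Fact affine_bracketDl p q r :
  affine_bracket (p + q) r = affine_bracket p r + affine_bracket q r.
Proof. by congr pair; rewrite /= ?addr0 //; ring. Qed.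

Fact affine_bracketDr p q r :
  affine_bracket p (q + r) = affine_bracket p q + affine_bracket p r.
Proof. by congr pair; rewrite /= ?addr0 //; ring. Qed.

Fact affine_bracketZl a p q :
  affine_bracket (a *: p) q = a *: affine_bracket p q.
Proof.
by congr pair; rewrite /= ?scaler0 // scalerBr -scalerAl -scalerAr.
Qed.

Fact affine_bracketZr a p q :
  affine_bracket p (a *: q) = a *: affine_bracket p q.
Proof.
by congr pair; rewrite /= ?scaler0 // scalerBr -scalerAl -scalerAr.
Qed.

Fact affine_bracketxx p : affine_bracket p p = 0.
Proof. by congr pair; rewrite subrr. Qed.

Fact affine_bracket_jacobi p q r :
  affine_bracket (affine_bracket p q) r + affine_bracket (affine_bracket q r) p
  + affine_bracket (affine_bracket r p) q = 0.
Proof. by congr pair; rewrite /= ?addr0 //; ring. Qed.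

HB.instance Definition _ := Lmodule_isLie.Build R affine_lie
  affine_bracketDl affine_bracketDr affine_bracketZl affine_bracketZr
  affine_bracketxx affine_bracket_jacobi.

Fact affine_bracket_metabelian (p q r s : affine_lie) :
  lie (lie p q) (lie r s) = 0.
Proof. by congr pair; rewrite /= !mulr0 subrr. Qed.

HB.instance Definition _ :=
  Lie_isMetabelian.Build R affine_lie affine_bracket_metabelian.

(** On the second component a generator acts as multiplication by its first
component, so [f] acts as multiplication by its value at the first components
of the generators. *)
Lemma affine_poly_act n (g : 'I_n -> affine_lie) (w : B) (f : {mpoly R[n]}) :
  poly_act g (0, w) f
  = (0, w * \sum_(m <- msupp f) f@_m *: \prod_(k < n) (g k).1 ^+ m k).
Proof.
have gen_act c k d :
    iter d (fun u => lie u (g k)) (0, c) = (0, c * (g k).1 ^+ d).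
  elim: d => [|d IH]; first by rewrite mulr1.
  by rewrite iterS IH; congr pair; rewrite /= mulr0 subr0 exprSr mulrA.
have act m c :
    monom_act g (0, c) m = (0, c * \prod_(k < n) (g k).1 ^+ m k).
  have -> : \prod_(k < n) (g k).1 ^+ m k = \prod_(k <- enum 'I_n) (g k).1 ^+ m k.
    by rewrite big_enum.
  rewrite /monom_act; elim: (enum 'I_n) c => [|k s IH] c; first by rewrite big_nil mulr1.
  by rewrite /= gen_act IH big_cons mulrA.
rewrite /poly_act; elim: (msupp f : seq _) => [|m s IH].
  by rewrite !big_nil mulr0.
rewrite !big_cons IH act; congr pair; rewrite /= ?scaler0 ?addr0 //.
by rewrite mulrDr scalerAr.
Qed.

End AffineLie.
Arguments affine_lie {R} B.

(** * Monomials of an annihilating polynomial *)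

Section Separation.
Context {R : comNzRingType} {n : nat} {G : rel 'I_n} {i j : 'I_n}.
Implicit Types (m : 'X_{1..n}) (f : {mpoly R[n]}).

(** Setting to zero the variables outside [T] kills the monomials that involve
them and fixes the others; a monomial [m] supported in [T] is among the
latter. *)
Lemma mcoeff_partial_eval (T : pred 'I_n) m f :
  (forall k, m k != 0%N -> T k) ->
  (\sum_(m' <- msupp f) f@_m' *:
     \prod_(k < n) (if T k then 'X_k else 0 : {mpoly R[n]}) ^+ m' k)@_m = f@_m.
Proof.
move=> Tm; rewrite [in RHS](mpolyE f) !raddf_sum /=.
apply: eq_bigr => m' _; rewrite !mcoeffZ mcoeffX; congr (_ * _).
have [Tm'|] := boolP [forall k, (m' k != 0%N) ==> T k].
  rewrite -mcoeffX mpolyXE_id; congr (mcoeff m _); apply: eq_bigr => k _.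
  by move/forallP/(_ k): Tm'; case: (T k) => //; rewrite implybF negbK => /eqP ->.
rewrite negb_forall => /existsP[k]; rewrite negb_imply => /andP[m'k nTk].
rewrite (bigD1 k) //= (negbTE nTk) expr0n (negbTE m'k) mul0r mcoeff0.
case: eqP => // Em; case/negP: nTk; apply: Tm.
by rewrite -Em.
Qed.

(** A step has to end in the support of [m] and away from [j], with no
condition on where it starts: walks from [i] thus have all their later vertices
available as interior vertices of a path to [j], whether or not [m] involves
[i]. *)
Definition support_edge m : rel 'I_n :=
  [rel k l | [&& G k l, m l != 0%N & l != j]].

Lemma support_component_path m k : i != j ->
  connect (support_edge m) i k -> G k j ->
  exists2 ys, is_path G i ys j & {in ys, forall y, m y != 0%N}.
Proof.
move=> neq_ij /connectP[p0 p0P ->]; case/shortenP: p0P => p pP up _ Gj.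
have pE y : y \in p -> (m y != 0%N) && (y != j).
  elim: p {Gj up} i pP => //= z p IH a /andP[/and3P[_ mz zj] pP].
  by rewrite in_cons => /predU1P[->|/(IH _ pP)//]; rewrite mz.
exists p => [|y /pE/andP[]//].
rewrite /is_path rcons_path Gj andbT; apply/andP; split.
  by apply: sub_path pP => a b /andP[].
rewrite -rcons_cons rcons_uniq up andbT in_cons negb_or eq_sym neq_ij /=.
by apply/negP => /pE/andP[_ /eqP].
Qed.

(** A morphism from M(X;G) to an algebra [affine_lie] detects the coefficient
at [m] when the support of [m] separates [i] from [j]. *)
Lemma annihilator_support_path f m :
  ssrbool.symmetric G -> i != j ->
  annihilator (pc_gen R G) (lie (pc_gen R G i) (pc_gen R G j)) f ->
  f@_m != 0 ->
  exists2 ys, is_path G i ys j & {in ys, forall y, m y != 0%N}.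
Proof.
move=> symG neq_ij annf; apply: contraNP => no_path; apply/eqP.
pose C := connect (support_edge m) i.
have C_not_adj k : C k -> ~~ G k j.
  by move=> Ck; apply/negP => Gkj; case: no_path; apply: support_component_path Gkj.
have Ci : C i by apply: connect0.
have C_support k : C k -> (k == i) || (m k != 0%N) && (k != j).
  case/connectP=> p; elim/last_ind: p => [_ ->|p y _]; first by rewrite eqxx.
  rewrite rcons_path last_rcons => /andP[_ /and3P[_ my yj]] ->.
  by rewrite my yj orbT.
have nCj : ~~ C j.
  by apply/negP => /C_support; rewrite eqxx andbF orbF eq_sym (negbTE neq_ij).
(* [i] and [j] are kept so that [x_i, x_j] is sent to the monomial x_i x_j,
   which is not a zero divisor. *)
pose T k := [|| k == i, k == j | m k != 0%N].
have CT k : C k -> T k.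
  by rewrite /T => /C_support/orP[->//|/andP[->]]; rewrite !orbT.
pose A : comAlgType R := {mpoly R[n]}.
pose y k : {mpoly R[n]} := if T k then 'X_k else 0.
pose a k : {mpoly R[n]} := if C k then 'X_k else 0.
have cross k l : G k l -> C k -> ~~ C l -> y l = 0.
  move=> Gkl Ck nCl; rewrite /y ifN //; apply: contra nCl.
  case/or3P=> [/eqP->//|/eqP lj|ml].
    by case/negP: (C_not_adj _ Ck); rewrite -lj.
  apply: (connect_trans Ck); apply: connect1.
  rewrite /support_edge /= Gkl ml /=.
  by apply: contraNneq (C_not_adj _ Ck) => <-.
pose g k : affine_lie A := (y k, a k).
have Gg k l : G k l -> lie (g k) (g l) = 0.
  move=> Gkl; congr pair; rewrite /= /a.
  case: (boolP (C k)) (boolP (C l)) => [Ck|nCk] [Cl|nCl].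
  - by rewrite /y !CT // mulrC subrr.
  - by rewrite (cross k l) // mulr0 mul0r subrr.
  - by rewrite (cross l k) 1?symG // mulr0 mul0r subrr.
  - by rewrite !mul0r subrr.
have [phi mphi phiE] := pc_metab_lift g G Gg.
have [_ _ phiL] := mphi.
(* The image of [x_i, x_j].f = 0 is computed in the second component. *)
have := lie_morphism_poly_act _ _ phi (pc_gen R G)
  (lie (pc_gen R G i) (pc_gen R G j)) f mphi.
rewrite annf (lie_morphism0 _ _ _ mphi) phiL !phiE.
have -> : lie (g i) (g j) = (0, 'X_[U_(i) + U_(j)]) :> affine_lie A.
  congr pair; rewrite /= /a Ci (negbTE nCj) mul0r subr0 /y /T eqxx orbT.
  by rewrite mpolyXD.
rewrite affine_poly_act => /(congr1 snd) /= /(congr1 (mcoeff (U_(i) + U_(j) + m)%MM)).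
rewrite mcoeff0 mulrC mcoeffMX => /esym <-.
under [in RHS]eq_bigr => m' _ do under eq_bigr => k _ do rewrite /= phiE.
by rewrite mcoeff_partial_eval // => k mk; rewrite /T mk !orbT.
Qed.

End Separation.

(** * The path ideal annihilates *)

Section PathsAnnihilate.
Context {R : comNzRingType} {n : nat} {G : rel 'I_n}.

(** If [k] is adjacent to [y], the Jacobi identity loses its term in
[[x_k, x_y]] and turns [[x_k, x_j].x_y] into [[x_y, x_j].x_k]: the first vertex
of the path is traded for the next one. *)
Lemma path_annihilates (i j : 'I_n) (ys : seq 'I_n) :
  path G i (rcons ys j) ->
  annihilator (pc_gen R G) (lie (pc_gen R G i) (pc_gen R G j))
    (\prod_(y <- ys) 'X_y).
Proof.
rewrite /annihilator.
have gen0 k l : G k l -> lie (pc_gen R G k) (pc_gen R G l) = 0.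
  move=> Gkl; rewrite -lie_proj_lie -lie_proj0; apply/lie_projP.
  by rewrite subr0; apply: LieIdeal_gen; exists k, l.
elim: ys i => [|y ys IH] k => [/andP[Gkj _]|/andP[Gky ysP]].
  by rewrite big_nil poly_act1 gen0.
rewrite big_cons poly_actM ?poly_actX; last exact: derived_lie.
rewrite lie_swap gen0 // lie0l add0r lie_anti -lieNl -lie_anti -poly_actX.
rewrite -poly_actM; last exact: derived_lie.
rewrite mulrC poly_actM; last exact: derived_lie.
by rewrite IH // poly_actX lie0l.
Qed.

(** An annihilator is an ideal, because polynomials act on the derived
subalgebra as on a module. *)
Lemma annihilator_ideal_gen (L : metabLieType R) (x : 'I_n -> L) u
    (S : {mpoly R[n]} -> Prop) f : derived u ->
  (forall g, S g -> annihilator x u g) -> ideal_gen S f -> annihilator x u f.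
Proof.
rewrite /annihilator => du Sann.
elim=> {f} [g /Sann//||g h _ gP _ hP|g h _ gP]; first exact: poly_act0.
  by rewrite poly_actD gP hP addr0.
rewrite mulrC poly_actM // gP /poly_act big1 // => m _.
by rewrite monom_act_0l scaler0.
Qed.

(** The vertices being distinct, each variable occurs at most once in the
product, so a positive exponent in [m] suffices. *)
Lemma path_monomial_dvd (ys : seq 'I_n) (m : 'X_{1..n}) :
  uniq ys -> {in ys, forall y, m y != 0%N} ->
  exists m', 'X_[m] = 'X_[m'] * \prod_(y <- ys) 'X_y :> {mpoly R[n]}.
Proof.
elim: ys m => [|y ys IH] m; first by exists m; rewrite big_nil mulr1.
move=> /= /andP[y_ys uys] mP.
have ym : (U_(y) <= m)%MM by rewrite lep1mP mP // mem_head.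
case: (IH (m - U_(y))%MM uys) => [z zys|m' Em].
  rewrite mnmBE mnm1E; case: (eqVneq y z) => [yz|_]; first by rewrite yz zys in y_ys.
  by rewrite subn0 mP // in_cons zys orbT.
exists m'; rewrite big_cons mulrCA -Em -mpolyXD; congr mpolyX.
by rewrite addmC submK.
Qed.

End PathsAnnihilate.

Theorem theorem4p7 (R : comNzRingType) (n : nat) (G : rel 'I_n)
    (symG : ssrbool.symmetric G) (irrG : irreflexive G)
    (i j : 'I_n) (neq_ij : i != j) (nadj_ij : ~~ G i j) (f : {mpoly R[n]}) :
  annihilator (pc_gen R G) (lie (pc_gen R G i) (pc_gen R G j)) f
  <-> path_ideal G i j f.
Proof.
split=> [annf|]; last first.
  rewrite /path_ideal; case: ifP => _ => [|->]; last exact: poly_act0.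
  apply: annihilator_ideal_gen => [|g [ys /andP[ysP _] ->]].
    exact: derived_lie.
  exact: path_annihilates.
have supp_path m : m \in msupp f ->
    exists2 ys, is_path G i ys j & {in ys, forall y, m y != 0%N}.
  by rewrite mcoeff_msupp; apply: annihilator_support_path.
rewrite /path_ideal; case: ifPn => [_|nconn]; last first.
  apply/mpolyP => m; rewrite mcoeff0; apply/eqP; apply: contraNT nconn.
  rewrite -mcoeff_msupp => /supp_path[ys /andP[ysP _] _].
  by apply/connectP; exists (rcons ys j); rewrite ?last_rcons.
rewrite (mpolyE f) big_seq; elim/big_ind: _ => [||m /supp_path[ys ysP my]].
- exact: IdealGen_0.
- exact: IdealGen_add.
have uys : uniq ys.
  by case/andP: ysP => _; rewrite /= rcons_uniq => /andP[_ /andP[]].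
have [m' ->] := path_monomial_dvd (R := R) ys m uys my.
by rewrite scalerAl; apply/IdealGen_mul/IdealGen_gen; exists ys.
Qed.
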